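(* For every integer $m\ge 2$, $$N_1(m)=\frac{R(m)+1}{2}.$$
   Context: $\pi(x)$ denotes the number of primes $p\le x$. For a positive integer $m$, $R(m)$ (the $m$-th Ramanujan prime) is the smallest positive integer such that for all integers $x\ge R(m)$ one has $\pi(x)-\pi(x/2)\ge m$. For a positive integer $m$, $N_1(m)$ is the smallest positive integer such that for every integer $n\ge N_1(m)$ the open interval $(n,2n)$ contains at least $m$ primes. *)

(* Defs.v *)
From HB Require Import structures.
From mathcomp Require Import all_boot all_order all_algebra.
From mathcomp Require Import boolp classical_sets.
Set Implicit Arguments.
Unset Strict Implicit.
Unset Printing Implicit Defensive.

Import Order.TTheory GRing.Theory Num.Theory.
Local Open Scope ring_scope.

(* The argument is rational because it is also taken at the half-integers
   x / 2; every natural number p <= x lies in the enumerated range. *)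
Definition primepi (x : rat) : nat :=
  count (fun p : nat => prime p && (p%:R <= x)) (iota 0 (Num.truncn x).+1).

Definition smallest_pos (P : nat -> Prop) (n : nat) : Prop :=
  [/\ (0 < n)%N, P n & forall k : nat, (0 < k)%N -> P k -> (n <= k)%N].

(* The default value 0, taken when no positive integer satisfies P, is never
   itself a smallest positive integer. *)
Definition least_pos (P : nat -> Prop) : nat := xget 0%N (smallest_pos P).

(* The difference is taken in int, so it is not truncated. *)
Definition ramanujan_prime (m : nat) : nat :=
  least_pos (fun r : nat => forall x : nat, (r <= x)%N ->
    (m%:Z <= (primepi x%:R)%:Z - (primepi (x%:R / 2))%:Z)%R).

Definition primes_between (a b : nat) : nat :=
  count (fun p : nat => prime p && (a < p)%N) (iota 0 b).

Definition N1 (m : nat) : nat :=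
  least_pos (fun k : nat => forall n : nat, (k <= n)%N ->
    (m <= primes_between n (2 * n))%N).

(* Main.v *)
Require Import Defs.
From mathcomp Require Import all_boot all_order all_algebra.
From mathcomp Require Import boolp classical_sets.
From mathcomp Require Import zify lra.

(** Let D(x) = pi(x) - pi(x/2) for a natural number x. For n > 1 the number of
    primes in (n, 2n) is D(2n), and D(2n+1) >= D(2n+2) for n > 0, because 2n+2
    is not prime. Hence, for m >= 2, if D(2n) >= m for all n >= N, then D >= m
    from 2N-1 on; conversely, if D >= m from r on, then D(2n) >= m for all
    n >= r/2. So the minima satisfy R = 2N-1.

    These minima exist because D(2n) tends to infinity, by Erdos' argument for
    Bertrand's postulate: 4^n / 2n <= 'C(2n, n), where the primes up to sqrt(2n)
    contribute at most 2n each, the others up to 2n/3 contribute at most their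
    product, which is <= 4^(2n/3), those in (2n/3, n] contribute nothing, and
    those in (n, 2n) contribute at most 2n each. *)

Set Implicit Arguments.
Unset Strict Implicit.
Unset Printing Implicit Defensive.

Import Order.TTheory GRing.Theory Num.Theory.

(** * Bounds on central binomial coefficients *)

Lemma mul_bin_odd n : n.+1 * 'C(n.*2.+1, n) = n.*2.+1 * 'C(n.*2, n).
Proof.
rewrite -(@bin_sub _ n); last by lia.
by rewrite (_ : n.*2.+1 - n = n.+1) -?mul_bin_diag //; lia.
Qed.

Lemma central_bin_even n : 'C(n.+1.*2, n.+1) = 2 * 'C(n.*2.+1, n).
Proof.
apply/eqP; rewrite -(eqn_pmul2l (ltn0Sn n)) doubleS -mul_bin_diag /= mulnA.
by apply/eqP; congr (_ * _); lia.
Qed.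

Lemma central_binS n : n.+1 * 'C(n.+1.*2, n.+1) = 2 * n.*2.+1 * 'C(n.*2, n).
Proof. by rewrite central_bin_even mulnCA mul_bin_odd mulnA. Qed.

Lemma central_bin_ge n : 0 < n -> 4 ^ n <= n.*2 * 'C(n.*2, n).
Proof.
elim: n => // -[|n] IH _; first by [].
rewrite expnS -doubleMl -mul2n central_binS.
have := IH isT; move: (4 ^ _) 'C(_, _) => a b; nia.
Qed.

Lemma central_bin_le n : 0 < n -> 2 * 'C(n.*2, n) <= 4 ^ n.
Proof.
elim: n => // -[|n] IH _; first by [].
have := central_binS n.+1; have := IH isT; rewrite (expnS 4 n.+1).
move: (4 ^ _) 'C(_, _) 'C(_, _) => a b c; nia.
Qed.

Lemma bin_odd_le n : 'C(n.*2.+1, n) <= 4 ^ n.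
Proof.
have := @central_bin_le n.+1 isT; rewrite central_bin_even expnS; lia.
Qed.

(** * Products over primes and the primorial bound *)

Lemma prod_primes_logn N M : 0 < M ->
    (forall p, prime p -> p %| M -> p <= N) ->
  \prod_(0 <= p < N.+1 | prime p) p ^ logn p M = M.
Proof.
move=> M0 hM; rewrite -[RHS](partnT M0) (@widen_partn (maxn N M)) ?leq_maxr//.
rewrite [RHS](@big_cat_nat _ _ _ N.+1) //=; last by rewrite ltnS leq_maxl.
rewrite [X in _ * X]big_nat_cond [X in _ * X]big1 ?muln1.
  rewrite big_mkcond [RHS]big_mkcond /=; apply: eq_bigr => p _.
  by case: ifP => // /negbT np; rewrite lognE (negbTE np).
move=> p /andP[/andP[hp _] _]; rewrite lognE.
case: and3P => // -[pp _ /(hM _ pp)].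
by rewrite leqNgt hp.
Qed.

(** Puts products with different bounds over one common range, so that they can be compared prime by
    prime. *)
Lemma prod_primes_restrict (F : nat -> nat) N a : a <= N ->
  \prod_(0 <= p < N.+1 | prime p) (if p <= a then F p else 1) =
  \prod_(0 <= p < a.+1 | prime p) F p.
Proof.
move=> aN; rewrite (@big_cat_nat _ _ _ a.+1) //= [X in _ * X]big_nat_cond.
rewrite [X in _ * X]big1 ?muln1; last first.
  by move=> p /andP[/andP[ap _] _]; rewrite leqNgt ap.
rewrite big_nat_cond [RHS]big_nat_cond; apply: eq_bigr => p.
move=> /andP[/andP[_ pa] _].
by rewrite -ltnS pa.
Qed.

Lemma prime_dvd_fact p n : prime p -> (p %| n`!) = (p <= n).
Proof.
move=> pp; apply/idP/idP => [|pn]; last by rewrite dvdn_fact // prime_gt0.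
elim: n => [|n IH]; first by rewrite dvdn1 => /eqP p1; rewrite p1 in pp.
by rewrite factS Euclid_dvdM // => /orP[/dvdn_leq->//|/IH/leqW].
Qed.

Lemma prime_dvd_bin_le p n m : prime p -> m <= n -> p %| 'C(n, m) -> p <= n.
Proof.
by move=> pp mn pd; rewrite -prime_dvd_fact // -(bin_fact mn) dvdn_mulr.
Qed.

(** Strong induction: an even bound above 2 is not prime and adds no factor; for a bound 2k+1, the
    primes above k+1 all divide 'C(2k+1, k) <= 4^k. *)
Lemma primorial_le n : \prod_(0 <= p < n.+1 | prime p) p <= 4 ^ n.
Proof.
elim/ltn_ind: n => -[|[|[|n]]] IH; try by rewrite unlock.
have [no|ne] := boolP (odd n.+3); last first.
  rewrite big_mkcond big_nat_recr //= -big_mkcond /= ifN ?muln1.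
    by apply: leq_trans (IH n.+2 _) _; rewrite // leq_exp2l.
  by apply/negP => pp; have := odd_prime_gt2; case: (even_prime pp) ne => // ->.
have [k nk k0] : exists2 k, n.+3 = k.*2.+1 & 0 < k.
  by exists n.+3./2 => //; rewrite -[LHS](odd_double_half n.+3) no.
rewrite nk; set M := 'C(k.*2.+1, k).
have M0 : 0 < M by rewrite bin_gt0; lia.
have -> : 4 ^ k.*2.+1 = 4 ^ k.+1 * 4 ^ k by rewrite -expnD; congr (4 ^ _); lia.
apply: leq_trans (leq_mul (IH k.+1 _) (bin_odd_le k)); last by lia.
rewrite -/M -[X in _ <= _ * X](@prod_primes_logn k.*2.+1) //; last first.
  by move=> p pp; apply: prime_dvd_bin_le => //; lia.
rewrite -(@prod_primes_restrict id k.*2.+1 k.+1) -?big_split /=; last by lia.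
rewrite big_nat_cond [leqRHS]big_nat_cond.
apply: leq_prod => p /andP[/andP[_ pn] pp]; have p0 := prime_gt0 pp.
have [pk|pk] := leqP p k.+1; first by rewrite leq_pmulr // expn_gt0 p0.
rewrite mul1n -[leqLHS]expn1 leq_exp2l ?prime_gt1 // -pfactor_dvdn // expn1.
(* As p > k+1, it divides (2k+1)! but neither k! nor (k+1)!, hence it divides [M]. *)
have : p %| k.*2.+1`! by rewrite prime_dvd_fact.
have kle : k <= k.*2.+1 by lia.
rewrite -(bin_fact kle) -/M !Euclid_dvdM // !prime_dvd_fact //.
by case/or3P => //; lia.
Qed.

(** * Prime powers in the central binomial coefficient *)

Lemma logn_fact_wide p n N : prime p -> n <= N ->
  logn p n`! = \sum_(1 <= k < N.+1) n %/ p ^ k.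
Proof.
move=> pp nN; rewrite logn_fact // [RHS](@big_cat_nat _ _ _ n.+1) //=.
rewrite [X in _ + X]big_nat_cond [X in _ + X]big1 ?addn0 // => k.
move=> /andP[/andP[nk _] _].
by rewrite divn_small // (leq_trans nk) // ltnW // ltn_expl // prime_gt1.
Qed.

(** Legendre's formula for (2n)! = 'C(2n, n) n!^2, written additively to avoid truncated
    subtraction. *)
Lemma logn_central_bin p n : prime p ->
  logn p 'C(n.*2, n) + \sum_(1 <= k < n.*2.+1) 2 * (n %/ p ^ k) =
  \sum_(1 <= k < n.*2.+1) n.*2 %/ p ^ k.
Proof.
move=> pp; have nn : n <= n.*2 by lia.
rewrite -!logn_fact_wide // -(bin_fact nn) (_ : n.*2 - n = n); last by lia.
rewrite !lognM ?muln_gt0 ?fact_gt0 ?bin_gt0 // -big_distrr /=.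
by rewrite -logn_fact_wide // mul2n addnn.
Qed.

Lemma sum_leq_nat t N : \sum_(1 <= k < N.+1) (k <= t) = minn N t.
Proof.
elim: N => [|N IH]; first by rewrite big_geq // min0n.
by rewrite big_nat_recr //= IH; lia.
Qed.

(** In Legendre's formula the k-th term is at most 1, and it is 0 once p^k > 2n; so the exponent is
    at most the integer logarithm of 2n in base p. *)
Lemma central_bin_pfactor_le p n : prime p -> 0 < n ->
  p ^ logn p 'C(n.*2, n) <= n.*2.
Proof.
move=> pp n0; have p1 := prime_gt1 pp; have p0 := prime_gt0 pp.
apply: leq_trans (_ : p ^ trunc_log p n.*2 <= _); last first.
  by apply: trunc_logP => //; rewrite double_gt0.
rewrite leq_exp2l //.
apply: leq_trans (geq_minr n.*2 (trunc_log p n.*2)); rewrite -sum_leq_nat.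
rewrite -(leq_add2r (\sum_(1 <= k < n.*2.+1) 2 * (n %/ p ^ k))).
rewrite logn_central_bin // -big_split /=; apply: leq_sum => k _.
have pk0 : 0 < p ^ k by rewrite expn_gt0 p0.
have [kt|kt] /= := leqP k (trunc_log p n.*2); last first.
  rewrite divn_small // ltnNge; apply/negP => /(trunc_log_max p1).
  by rewrite leqNgt kt.
by rewrite -ltnS ltn_divLR //; have := ltn_ceil n pk0; nia.
Qed.

(** For k = 1 the quotients of n and 2n by p are 1 and 2, which cancel; for k >= 2, p^k >= 3p >
    2n. *)
Lemma central_bin_logn0 p n : prime p -> 2 < p -> p <= n -> n.*2 < 3 * p ->
  logn p 'C(n.*2, n) = 0.
Proof.
move=> pp p2 pn np; apply/eqP; rewrite -leqn0.
rewrite -(leq_add2r (\sum_(1 <= k < n.*2.+1) 2 * (n %/ p ^ k))).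
rewrite logn_central_bin // add0n big_nat_cond [leqRHS]big_nat_cond.
apply: leq_sum.
case=> [//|[|k]] _.
  have : 0 < n %/ p ^ 1 by rewrite expn1 divn_gt0 // prime_gt0.
  have : n.*2 %/ p ^ 1 < 3 by rewrite expn1 ltn_divLR ?prime_gt0.
  lia.
rewrite divn_small // (leq_trans np) // (@leq_trans (p ^ 2)) //.
  by rewrite -mulnn leq_mul.
by rewrite leq_exp2l // prime_gt1.
Qed.

(** * Bounding the central binomial coefficient by primes in (n, 2n) *)

Lemma prod_const_count (x : nat) (r : seq nat) (P Q : pred nat) :
  \prod_(p <- r | P p) (if Q p then x else 1) =
  x ^ count (fun p => P p && Q p) r.
Proof. by rewrite -big_mkcondr big_const_seq iter_muln_1. Qed.

Lemma count_iota_leq (P : pred nat) s N :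
  count (fun p => P p && (p <= s)) (iota 0 N) <= s.+1.
Proof.
rewrite -size_filter -[X in _ <= X](size_iota 0) uniq_leq_size //.
  by rewrite filter_uniq // iota_uniq.
by move=> p; rewrite mem_filter !mem_iota => /andP[/andP[_ ps] _].
Qed.

Lemma primes_between_double n : 1 < n ->
  primes_between n (2 * n) =
  count (fun p => prime p && (n < p)) (iota 0 n.*2.+1).
Proof.
move=> n1; rewrite /primes_between mul2n -(addn1 n.*2) iotaD count_cat /= add0n.
suff /negbTE-> : ~~ prime n.*2 by rewrite /= !addn0.
by apply/negP => /even_prime[|]; rewrite ?odd_double //; lia.
Qed.

Lemma central_bin_le_primes n s : 2 < n -> n.*2 < s.+1 ^ 2 ->
  'C(n.*2, n) <=
  n.*2 ^ s.+1 * 4 ^ (n.*2 %/ 3) * n.*2 ^ primes_between n (2 * n).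
Proof.
move=> n2 ns; set M := 'C(n.*2, n).
have M0 : 0 < M by rewrite bin_gt0; lia.
rewrite -[leqLHS](@prod_primes_logn n.*2) //; last first.
  by move=> p pp; apply: prime_dvd_bin_le => //; lia.
have h1 := @count_iota_leq prime s n.*2.+1.
(* One conditional factor for each range of primes allows a comparison prime by prime; the ranges
   may overlap, since every factor is at least 1. *)
apply: (@leq_trans (\prod_(0 <= p < n.*2.+1 | prime p)
   ((if p <= s then n.*2 else 1) * (if p <= n.*2 %/ 3 then p else 1) *
    (if n < p then n.*2 else 1)))); last first.
  rewrite !big_split /= primes_between_double; last by lia.
  rewrite (@prod_primes_restrict id _ (n.*2 %/ 3)) ?leq_div //.
  rewrite !prod_const_count /index_iota subn0.
  by rewrite !leq_mul ?primorial_le // leq_pexp2l //; lia.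
apply: leq_prod => p pp; have p0 := prime_gt0 pp; have p1 := prime_gt1 pp.
have hp : p ^ logn p M <= n.*2 by apply: central_bin_pfactor_le => //; lia.
have [ps|sp] := leqP p s.
  apply: leq_trans hp _; rewrite -mulnA leq_pmulr // muln_gt0.
  by apply/andP; split; case: ifP; lia.
have [np|pn] := ltnP n p.
  by apply: leq_trans hp _; rewrite mul1n leq_pmull //; case: ifP.
(* Since p > s, p^2 >= (s+1)^2 > 2n, so the exponent is at most 1. *)
rewrite mul1n muln1; have v1 : logn p M <= 1.
  rewrite -ltnS -(ltn_exp2l _ _ p1) (leq_ltn_trans hp) // (leq_trans ns) //.
  by rewrite leq_exp2r.
have [pm|mp] := leqP p; first by rewrite -[X in _ <= X]expn1 leq_exp2l.
rewrite central_bin_logn0 //; first by lia.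
by move: mp; rewrite ltn_divLR //; lia.
Qed.

Lemma expn4_le_primes n s : 2 < n -> n.*2 < s.+1 ^ 2 ->
  4 ^ (n %/ 3) <= n.*2 ^ (s.+2 + primes_between n (2 * n)).
Proof.
move=> n2 ns; rewrite -(leq_pmul2r (_ : 0 < 4 ^ (n.*2 %/ 3))) ?expn_gt0 //.
rewrite -expnD; apply: leq_trans (_ : 4 ^ n <= _).
  by rewrite leq_exp2l //; lia.
apply: leq_trans (central_bin_ge _) _; first by lia.
apply: leq_trans (leq_mul (leqnn _) (central_bin_le_primes n2 ns)) _.
by rewrite expnD (expnS _ s.+1); lia.
Qed.

(** * The number of primes in (n, 2n) tends to infinity *)

(** The base case rests on 20^2 <= 2^9. For the step, (L+1)^2 <= 1.2 L^2 gives (L+1)^4 <= 1.44 L^4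
    <= 2 L^4. *)
Lemma pow4_le_exp2 L : 20 <= L -> L ^ 4 <= 2 ^ L.-1.
Proof.
elim: L => // L IH; rewrite leq_eqVlt => /predU1P[<-|L20].
  have sq a b : a ^ 2 <= b -> a ^ 4 <= b ^ 2 by rewrite (expnM a 2 2) leq_sqr.
  by apply: leq_trans (sq 20 (2 ^ 9) isT) _; rewrite -expnM leq_exp2l.
have {IH} := IH L20; rewrite [L.+1.-1](_ : _ = L.-1.+1); last by lia.
rewrite (expnS 2) -[4]/(2 * 2) !expnM.
have : 10 * L.+1 ^ 2 <= 12 * L ^ 2 by rewrite -!mulnn; nia.
move: (L ^ 2) (L.+1 ^ 2) (2 ^ _) => a b c; rewrite -!mulnn => ab ac.
have : (10 * b) * (10 * b) <= (12 * a) * (12 * a) by rewrite leq_mul.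
by lia.
Qed.

Lemma sqrt_floor n : exists s, s ^ 2 <= n < s.+1 ^ 2.
Proof.
elim: n => [|n [s /andP[sn ns]]]; first by exists 0.
have [h|h] := ltnP n.+1 (s.+1 ^ 2); first by exists s; rewrite h ltnW.
by exists s.+1; rewrite h /= (leq_trans (_ : _ <= (s.+1 ^ 2).+1)) // ltn_sqr.
Qed.

Lemma primes_between_unbounded m :
  exists n0, forall n, n0 <= n -> m <= primes_between n (2 * n).
Proof.
(* The bound 2^20 makes the binary logarithm L of 2n at least 20; (m+2)^2 makes m+2 at most s, the
   integer square root of 2n. *)
exists (maxn (2 ^ 20) (m.+2 ^ 2)) => n; rewrite geq_max => /andP[n20 nm].
have n11 : 2 ^ 11 < n by apply: leq_trans n20; rewrite ltn_exp2l.
have n8 : 8 <= n by apply: leq_trans n20; rewrite (@leq_exp2l 2 3).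
have [s /andP[sn ns]] := sqrt_floor n.*2.
rewrite leqNgt; apply/negP => gm.
have sm : m.+2 <= s.
  by rewrite -ltnS -ltn_sqr; apply: leq_ltn_trans nm (leq_ltn_trans _ ns); lia.
have n2 : 1 < n.*2 by lia.
have /= := up_log_bounds (ltnSn 1) n2; set L := up_log 2 n.*2 => /andP[Ln nL].
have L20 : 20 <= L.
  by rewrite -(@leq_exp2l 2) // (leq_trans n20) // (leq_trans _ nL) //; lia.
have := @expn4_le_primes n s; rewrite ns => /(_ _ isT) h.
have {h} : 4 ^ (n %/ 3) <= (2 ^ L) ^ (s.+2 + primes_between n (2 * n)).
  by apply: leq_trans (h _) _; [lia | rewrite leq_exp2r //; lia].
rewrite -expnM -(expnM 2 2) leq_exp2l // => h.
(* With fewer than m primes the exponent is below 2s. Fourth powers, with L^4 <= 2n and s^4 <= 4n^2,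
   then give n^4 <= 2^11 n^3, against n > 2^11. *)
have {}h : n <= 4 * (L * s) by nia.
have : n ^ 4 <= (4 * (L * s)) ^ 4 by rewrite leq_exp2r.
have : L ^ 4 <= n.*2 by apply: leq_trans (pow4_le_exp2 L20) (ltnW Ln).
have : (s ^ 2) ^ 2 <= n.*2 ^ 2 by rewrite leq_sqr.
rewrite (expnMn 4) (expnMn L) -(expnM s 2 2) => hs hL hn.
have : n ^ 4 <= 2 ^ 11 * n ^ 3.
  apply: leq_trans hn _; apply: leq_trans (leq_mul (leqnn _) (leq_mul hL hs)) _.
  rewrite -[4 ^ 4](expnM 2 2 4) (expnD 2 8 3).
  by move: (2 ^ 8) => c; rewrite !expnS expn0; lia.
rewrite (expnS n 3) leq_pmul2r ?expn_gt0 1?leqNgt ?n11 //; lia.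
Qed.

(** * Existence and uniqueness of least positive integers *)

Lemma smallest_pos_uniq P a b : smallest_pos P a -> smallest_pos P b -> a = b.
Proof.
case=> a0 Pa amin [b0 Pb bmin]; apply/eqP.
by rewrite eqn_leq amin // bmin.
Qed.

Lemma least_posP P n : smallest_pos P n -> least_pos P = n.
Proof.
move=> Pn; rewrite /least_pos; case: xgetP => [k _ Pk|/(_ n)//].
exact: smallest_pos_uniq Pk Pn.
Qed.

Lemma ex_smallest_pos P :
  (exists2 k, 0 < k & P k) -> exists n, smallest_pos P n.
Proof.
case=> k k0 Pk.
have exP : exists k, (0 < k) && `[< P k >].
  by exists k; rewrite k0; apply/asboolP.
case: (ex_minnP exP) => n /andP[n0 /asboolP Pn] nmin.
by exists n; split=> // j j0 Pj; apply: nmin; rewrite j0; apply/asboolP.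
Qed.

(** * Counting primes in (x/2, x] *)

(** This is D(x): a natural number exceeds x/2 exactly when it exceeds the integer part [x./2]. *)
Definition primes_above_half x :=
  count (fun p => prime p && (x./2 < p)) (iota 0 x.+1).

Lemma primepi_nat x : primepi x%:R = count prime (iota 0 x.+1).
Proof.
rewrite /primepi natrK; apply: eq_in_count => p.
by rewrite mem_iota ler_nat ltnS => /andP[_ ->]; rewrite andbT.
Qed.

Lemma primepi_half x : primepi (x%:R / 2) = count prime (iota 0 x./2.+1).
Proof.
have x2 : (x%:R = x./2%:R * 2 + (odd x)%:R :> rat)%R.
  by rewrite -[in LHS](odd_double_half x) -muln2 addnC natrD natrM.
have : (0 <= (odd x)%:R :> rat)%R by exact: ler0n.
have : ((odd x)%:R <= 1 :> rat)%R by rewrite lern1 leq_b1.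
move: x2; set b : rat := (odd x)%:R%R => x2 b1 b0.
have -> : primepi (x%:R / 2) = primepi (x./2)%:R; last exact: primepi_nat.
have tr : Num.truncn (x%:R / 2 : rat)%R = x./2.
  by apply/eqP; rewrite truncn_eq ?divr_ge0 // -(natr1 x./2); lra.
rewrite /primepi tr natrK; apply: eq_in_count => p.
rewrite mem_iota ltnS => /andP[_ px]; rewrite ler_nat px; congr (_ && _).
by move: px; rewrite -(ler_nat rat) => px; lra.
Qed.

Lemma primepi_sub_half x :
  ((primepi x%:R)%:Z - (primepi (x%:R / 2))%:Z = (primes_above_half x)%:Z)%R.
Proof.
rewrite primepi_nat primepi_half /primes_above_half.
have -> : x.+1 = x./2.+1 + (x - x./2) by lia.
rewrite iotaD !count_cat add0n; set s := iota 0 _; set t := iota x./2.+1 _.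
have -> : count (fun p => prime p && (x./2 < p)) s = 0.
  rewrite -[RHS](count_pred0 s); apply: eq_in_count => p.
  by rewrite mem_iota; case: prime => //=; lia.
have -> : count (fun p => prime p && (x./2 < p)) t = count prime t.
  by apply: eq_in_count => p; rewrite mem_iota; case: prime => //=; lia.
lia.
Qed.

Lemma primes_above_half_double n : 1 < n ->
  primes_above_half n.*2 = primes_between n (2 * n).
Proof.
by move=> n1; rewrite primes_between_double // /primes_above_half doubleK.
Qed.

Lemma primes_above_half_even_le n : 0 < n ->
  primes_above_half n.+1.*2 <= primes_above_half n.*2.+1.
Proof.
move=> n0; rewrite primes_above_half_double // primes_between_double //.
rewrite /primes_above_half (_ : n.*2.+1./2 = n); last by lia.
rewrite doubleS -[n.*2.+3]addn1 iotaD count_cat /= add0n.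
suff /negbTE-> : ~~ prime n.*2.+2.
  by rewrite /= !addn0; apply: sub_count => p /andP[-> /ltnW].
by apply/negP => /even_prime[|]; rewrite -doubleS ?odd_double //; lia.
Qed.

(** * Comparison of the two minima *)

Local Open Scope ring_scope.

Theorem proposition2 (m : nat) (hm : (2 <= m)%N) :
  (N1 m)%:R = ((ramanujan_prime m)%:R + 1) / 2 :> rat.
Proof.
pose Q k := forall n, (k <= n)%N -> (m <= primes_between n (2 * n))%N.
have [N N_min] : exists N, smallest_pos Q N.
  apply: ex_smallest_pos; have [n0 hn0] := primes_between_unbounded m.
  by exists n0.+1 => // n /ltnW; apply: hn0.
have N_eq : N1 m = N by apply: least_posP.
have [N0 QN minN] := N_min.
(* The open interval (1, 2) contains no prime. *)
have N_gt1 : (1 < N)%N.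
  rewrite ltnNge; apply/negP => /QN; rewrite leqNgt => /negP; apply.
  exact: leq_trans hm.
suff R_eq : ramanujan_prime m = N.*2.-1.
  rewrite N_eq R_eq natr1 prednK ?double_gt0 // -muln2 natrM mulfK //.
apply: least_posP; split=> [|x|r r0 Pr]; first by lia.
(* Let x >= 2N-1. If x = 2i+1, then i+1 >= N and D(x) >= D(2i+2); if x = 2i, then i >= N by
   parity. *)
- rewrite primepi_sub_half lez_nat -(odd_double_half x).
  move: (x./2) => i; case: odd => /= Ni.
    have i0 : (0 < i)%N by lia.
    apply: leq_trans (primes_above_half_even_le i0).
    by rewrite primes_above_half_double //; apply: QN; lia.
  by rewrite add0n primes_above_half_double; [apply: QN|]; lia.
(* Rounding r/2 up suffices: it is the least n with 2n >= r, and N <= [uphalf r] means 2N-1 <= r. *)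
- suff: (N <= uphalf r)%N by lia.
  apply: minN => [|n rn]; first by lia.
  have := Pr n.*2; rewrite primepi_sub_half lez_nat => /(_ _).
  have [n1|n1] := ltnP 1 n.
    by rewrite primes_above_half_double //; apply; lia.
  (* At n = 1 the prime 2 counts in D(2) = 1 but is not in (1, 2); the hypothesis m >= 2 rules this
     case out. *)
  have -> : n = 1%N by lia.
  by move=> h; have := leq_trans hm (h ltac:(lia)).
Qed.
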